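(* Let $p,q$ be odd primes, let $n_2\ge 1$ be an integer, and let $N=p^2q^{n_2}$. If $(q-1)\nmid (p-1)^2(p+1)$, then $N$ satisfies the ISAP.
   Context: **ISAP.** For a positive integer $N$ and a set $D$ of divisors $d$ of $N$ with $1\le d<N$, let $ICG_N(D)$ be the graph on vertex set $\mathbb{Z}/N\mathbb{Z}$ in which $i,j$ are adjacent iff $\gcd(i-j,N)\in D$. (These are exactly the integral circulant graphs of order $N$; $D$ is the integral symbol.) The spectrum of a graph is the multiset of eigenvalues of its adjacency matrix. $N$ satisfies the integral spectral Ádám property (ISAP) if for any two such sets $D,D'$, the graphs $ICG_N(D)$ and $ICG_N(D')$ have the same spectrum if and only if $D=D'$. *)

(* Defs.v *)
From mathcomp Require Import all_boot all_order all_algebra all_field.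
From mathcomp Require Import finmap multiset.

Set Implicit Arguments.
Unset Strict Implicit.
Unset Printing Implicit Defensive.

Import GRing.Theory.
Local Open Scope ring_scope.
Local Open Scope mset_scope.

Definition adjacency_mx (n : nat) (e : rel 'I_n) : 'M[algC]_n :=
  \matrix_(i, j) (e i j)%:R.

(* Eigenvalues are taken in algC, over which the characteristic polynomial
   splits, and are counted with their multiplicity as roots of it. *)
Definition mx_spectrum (n : nat) (A : 'M[algC]_n) : {mset algC} :=
  seq_mset (sval (closed_field_poly_normal (char_poly A))).

Definition graph_spectrum (n : nat) (e : rel 'I_n) : {mset algC} :=
  mx_spectrum (adjacency_mx e).

Definition integral_symbol (N : nat) (D : {fset nat}) : Prop :=
  forall d : nat, d \in D -> [/\ (d %| N)%N, (1 <= d)%N & (d < N)%N].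

(* The vertex set Z/NZ is represented by the residues 'I_N; `|i - j|%N is the
   absolute difference of i and j as integers (not truncated subtraction). *)
Definition ICG (N : nat) (D : {fset nat}) : rel 'I_N :=
  fun i j => gcdn `|i%:Z - j%:Z|%N N \in D.
Arguments ICG N D : clear implicits.

Definition ISAP (N : nat) : Prop :=
  forall D D' : {fset nat}, integral_symbol N D -> integral_symbol N D' ->
    (graph_spectrum (ICG N D) = graph_spectrum (ICG N D') <-> D = D').

(* Main.v *)
(* The eigenvalue of ICG_N(D) at l depends only on gcd(l, N), and is a sum
   of products of Ramanujan sums c_{p^a}(l) c_{q^b}(l).  The class of l with
   N / gcd(l, N) = p^a q^b has phi(p^a) phi(q^b) elements, a multiple of q - 1
   when b > 0.  Modulo q - 1, the spectrum thus only sees the three eigenvalues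
     W_0 + (p - 1) W_1 + p (p - 1) W_2,  W_0 + (p - 1) W_1 - p W_2,  W_0 - W_1
   with weights 1, p - 1, p (p - 1), where W_a is the sum of phi(q^b) over the b
   with N / (p^a q^b) in D.  The hypothesis makes the first two recognizable,
   and also the third unless q - 1 divides p (p - 1).  If all three are known,
   so are W_0, W_1, W_2, and hence D, because sums of distinct phi(q^b)
   determine their terms.  Otherwise p < q - 1, and W_2 and W_0 + (p - 1) W_1
   suffice: the latter is an expansion in base (phi(q^b))_b with digits at most
   p, which is unique and whose digits 0, 1, p - 1, p are distinct. *)

Require Import Defs.
From mathcomp Require Import all_boot.
From mathcomp Require Import all_algebra all_field.
From mathcomp Require Import finmap multiset ring zify.

Import GRing.Theory Num.Theory.
Local Open Scope ring_scope.

(** * Spectra of circulant graphs *)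

Lemma mx_spectrum_diagonalizable (n : nat) (A F : 'M[algC]_n) (d : 'rV_n) :
  \det F != 0 -> F *m A = diag_mx d *m F ->
  mx_spectrum A = seq_mset [seq d 0 i | i <- enum 'I_n].
Proof.
move=> detF FA.
have charA : char_poly A = \prod_(i < n) ('X - (d 0 i)%:P).
  have -> : \prod_(i < n) ('X - (d 0 i)%:P) = char_poly (diag_mx d).
    rewrite char_poly_trig ?diag_mx_is_trig //.
    by apply: eq_bigr => i _; rewrite mxE eqxx mulr1n.
  (* Over the polynomial ring the nonzero determinant of [F] cancels from both sides, so no inverse
     of [F] has to be formed. *)
  pose PF := map_mx polyC F.
  have : PF *m char_poly_mx A = char_poly_mx (diag_mx d) *m PF.
    rewrite /char_poly_mx mulmxBr mulmxBl -!map_mxM FA.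
    by rewrite scalar_mxC.
  move/(congr1 determinant); rewrite !det_mulmx mulrC => /mulIf; apply.
  by rewrite det_map_mx polyC_eq0.
rewrite /mx_spectrum; apply/eq_seq_msetP/prod_XsubC_eq.
case: closed_field_poly_normal => s /= charAs.
have := charAs; rewrite (monicP (char_poly_monic A)) scale1r => <-.
by rewrite charA big_map big_enum.
Qed.

(* For [w] a primitive [N]-th root of unity, the eigenvalue of [ICG N D] on the
   character [k |-> w ^+ (k * l)]. *)
Definition icg_eigenvalue (N : nat) (D : {fset nat}) (w : algC) (l : nat) :=
  \sum_(k < N) (gcdn k N \in D)%:R * w ^+ (k * l).

(** The adjacency matrix is circulant, hence diagonalized by the Fourier matrix. This is a
    Vandermonde matrix in the distinct powers of [w], so its determinant is nonzero. *)
Lemma icg_spectrum (N : nat) (D : {fset nat}) (w : algC) :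
  N.-primitive_root w ->
  graph_spectrum (ICG N D) =
    seq_mset [seq icg_eigenvalue N D w l | l <- iota 0 N].
Proof.
move=> w_prim; have N_gt0 := prim_order_gt0 w_prim.
case: N N_gt0 w_prim => // n _ w_prim.
pose F := Vandermonde n.+1 (\row_(j < n.+1) w ^+ j).
rewrite /graph_spectrum.
rewrite (@mx_spectrum_diagonalizable _ _ F (\row_i icg_eigenvalue n.+1 D w i)).
- congr seq_mset; rewrite -val_enum_ord -map_comp.
  by apply: eq_map => i; rewrite mxE.
- rewrite det_Vandermonde; apply/prodf_neq0 => i _; apply/prodf_neq0 => j ij.
  rewrite !mxE subr_eq0 (eq_prim_root_expr w_prim) !modn_small //.
  by rewrite gtn_eqF.
apply/matrixP => i j; rewrite mul_diag_mx !mxE.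
rewrite (reindex_inj (addIr j)) /icg_eigenvalue big_distrl /=.
apply: eq_bigr => k _; rewrite !mxE /= /ICG /=.
(* If [k + j] wraps around, the absolute difference is [n.+1 - k] instead of [k], with the same gcd
   with [n.+1]. *)
have -> : gcdn `|((k + j) %% n.+1)%:Z - j%:Z|%N n.+1 = gcdn k n.+1.
  have [kj|kj] := ltnP (k + j) n.+1.
    by rewrite modn_small // PoszD addrK absz_nat.
  rewrite -(subnK kj) modnDr modn_small; last by have := ltn_ord k; have := ltn_ord j; lia.
  have -> : `|(k + j - n.+1)%N%:Z - j%:Z|%N = (n.+1 - k)%N.
    by have := ltn_ord k; lia.
  have gcd_sub a b : (a <= b)%N -> gcdn (b - a) b = gcdn a b.
    by move=> /subnK {2 3}<-; rewrite gcdnDl gcdnDr gcdnC.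
  by rewrite gcd_sub // ltnW.
rewrite (prim_expr_mod w_prim) mulrC -mulrA; congr (_ * _).
by rewrite -!exprM -exprD mulnDl.
Qed.

(** * Geometric sums, Ramanujan sums and gcds with prime powers *)

Lemma sum_dvdn (R : nmodType) (d M : nat) (f : nat -> R) : (0 < d)%N ->
  \sum_(k < d * M | (d %| k)%N) f k = \sum_(i < M) f (d * i)%N.
Proof.
move=> d_gt0; rewrite -(big_mkord (fun k => d %| k)%N).
elim: M => [|M IH]; first by rewrite muln0 big_geq // big_ord0.
rewrite (@big_cat_nat _ _ _ (d * M)) //=; last by rewrite leq_mul2l leqnSn orbT.
rewrite IH big_ord_recr /=; congr (_ + _).
rewrite big_ltn_cond ?ltn_pmul2l // dvdn_mulr // big_nat_cond big_pred0 ?addr0 //.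
move=> k; apply/negP => /andP[/andP[lt_k k_lt] /dvdnP[c k_def]].
by move: lt_k k_lt; rewrite k_def (mulnC c) !ltn_pmul2l // ltnS => /leq_trans le /le; rewrite ltnn.
Qed.

(** A geometric sum of ratio [w ^+ (d * l)], an [M]-th root of unity that is 1 exactly when [M]
    divides [l]; otherwise multiplying by the ratio minus 1 telescopes to 0. *)
Lemma sum_prim_root_dvdn (R : idomainType) (d M l : nat) (w : R) :
  (d * M)%N.-primitive_root w ->
  \sum_(k < d * M | (d %| k)%N) w ^+ (k * l) = (M * (M %| l))%N%:R.
Proof.
move=> w_prim; have := prim_order_gt0 w_prim; rewrite muln_gt0 => /andP[d_gt0 M_gt0].
rewrite (@sum_dvdn _ d M (fun k => w ^+ (k * l))) //.
have w1 : (w ^+ (d * l) == 1) = (M %| l)%N.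
  by rewrite -(prim_order_dvd w_prim) dvdn_pmul2l.
under eq_bigr => i _ do rewrite mulnAC exprM.
case: eqP w1 => [-> <-|/eqP w_neq1 <-].
  by under eq_bigr => i _ do rewrite expr1n; rewrite sumr_const card_ord muln1.
apply/eqP; rewrite muln0 -(mulrI_eq0 _ (mulfI (_ : w ^+ (d * l) - 1 != 0))) ?subr_eq0 //.
by rewrite -subrX1 -exprM mulnAC exprM (prim_expr_order w_prim) expr1n subrr.
Qed.

(* For [r] prime, the sum of the [l]-th powers of the primitive [r ^ a]-th roots
   of unity; the factor [0 < a] guards the junk value [0.-1 = 0]. *)
Definition ramanujan_sum (R : pzRingType) (r a l : nat) : R :=
  (r ^ a * (r ^ a %| l))%N%:R
    - (0 < a)%N%:R * (r ^ a.-1 * (r ^ a.-1 %| l))%N%:R.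

(** The gcd is a power of [p], and its exponent equals [m - a] iff it is at least [m - a] but not at
    least [m - a + 1]. For [a = 0] the exponent is already maximal, and the factor [0 < a] removes
    the second condition. *)
Lemma gcdn_prime_power_eqE (R : pzRingType) (p m a k : nat) :
  prime p -> (a <= m)%N ->
  (gcdn k (p ^ m) == p ^ (m - a))%N%:R
    = (p ^ (m - a) %| k)%N%:R
        - (0 < a)%N%:R * (p ^ (m - a.-1) %| k)%N%:R :> R.
Proof.
move=> p_prime a_le; have p_gt1 := prime_gt1 p_prime.
have /(dvdn_pfactor _ _ p_prime)[e e_le ge] := dvdn_gcdr k (p ^ m).
have dvdE i : (i <= m)%N -> (p ^ i %| k)%N = (i <= e)%N.
  by move=> i_le; rewrite -(dvdn_Pexp2l _ _ p_gt1) -ge dvdn_gcd dvdn_exp2l ?andbT.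
rewrite ge eqn_exp2l // !dvdE ?leq_subr //.
case: a a_le => [|a] a_le /=; first by rewrite subn0 mul0r subr0 eqn_leq e_le.
rewrite mul1r (_ : m - a = (m - a.+1).+1)%N; last by lia.
by rewrite eqn_leq; case: ltngtP => //=; rewrite ?subr0 ?subrr.
Qed.

Lemma eqn_prime_powerM (p q i j i' j' : nat) :
  prime p -> prime q -> p != q ->
  (p ^ i * q ^ j == p ^ i' * q ^ j')%N = (i == i') && (j == j').
Proof.
move=> p_prime q_prime pq; have p0 := prime_gt0 p_prime; have q0 := prime_gt0 q_prime.
apply/eqP/andP => [E|[/eqP-> /eqP->] //].
have := congr1 (logn p) E; have := congr1 (logn q) E.
rewrite !lognM ?expn_gt0 ?p0 ?q0 // !lognX !logn_prime // !eqxx.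
by rewrite (eq_sym q) (negbTE pq) !muln0 !muln1 !add0n !addn0 => -> ->.
Qed.

Lemma coprime_prime_powers (p q i j : nat) :
  prime p -> prime q -> p != q -> coprime (p ^ i) (q ^ j).
Proof.
by move=> *; rewrite coprimeXl ?coprimeXr // prime_coprime // dvdn_prime2.
Qed.

Lemma gcdnM_coprime (k x y : nat) :
  coprime x y -> gcdn k (x * y) = (gcdn k x * gcdn k y)%N.
Proof.
move=> xy; apply/eqP; rewrite eqn_dvd; apply/andP; split.
  rewrite muln_gcdl !muln_gcdr !dvdn_gcd dvdn_gcdr.
  by rewrite !(dvdn_mulr _ (dvdn_gcdl _ _), dvdn_mull _ (dvdn_gcdl _ _)).
rewrite Gauss_dvd ?dvdn_gcd ?dvdn_gcdl ?(dvdn_mulr _ (dvdn_gcdr _ _)) //.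
  by rewrite dvdn_mull ?dvdn_gcdr.
by apply: coprime_dvdl (dvdn_gcdr _ _) (coprime_dvdr (dvdn_gcdr _ _) xy).
Qed.

Lemma totient1 : totient 1 = 1%N. Proof. by []. Qed.

(** The coefficient of the Ramanujan sum for [p ^ a] in the eigenvalues at multiples of [q ^ n].
    Divisors are indexed by their codivisor [p ^ a * q ^ b]. *)
Definition symbol_weight (p q m n : nat) (D : {fset nat}) (a : nat) : nat :=
  \sum_(b < n.+1) (p ^ (m - a) * q ^ (n - b) \in D)%N * totient (q ^ b).

(** * Eigenvalues and multiplicities for an order with two prime factors *)

Section TwoPrimes.
Variables (p q m n : nat).
Hypotheses (p_prime : prime p) (q_prime : prime q) (p_neq_q : p != q).
Local Notation N := (p ^ m * q ^ n)%N.

Let coprime_pq i j : coprime (p ^ i) (q ^ j).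
Proof. exact: coprime_prime_powers. Qed.

Local Notation dv a b := (p ^ (m - a) * q ^ (n - b))%N.

Let gcdE k a b : (a <= m)%N -> (b <= n)%N ->
  (gcdn k N == dv a b)
    = (gcdn k (p ^ m) == p ^ (m - a))%N && (gcdn k (q ^ n) == q ^ (n - b))%N.
Proof.
move=> a_le b_le.
have /(dvdn_pfactor _ _ p_prime)[e e_le ge] := dvdn_gcdr k (p ^ m).
have /(dvdn_pfactor _ _ q_prime)[f f_le gf] := dvdn_gcdr k (q ^ n).
rewrite (gcdnM_coprime k _ _ (coprime_pq m n)).
by rewrite ge gf eqn_prime_powerM // !eqn_exp2l ?prime_gt1.
Qed.

(* The indicator of [gcdn k N = dv a b] is a product of two differences of
   divisibility indicators; expanding it leaves four geometric sums. *)
Lemma sum_prim_root_gcdn (R : idomainType) (w : R) (a b l : nat) :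
  N.-primitive_root w -> (a <= m)%N -> (b <= n)%N ->
  \sum_(k < N | gcdn k N == dv a b) w ^+ (k * l)
    = ramanujan_sum R p a l * ramanujan_sum R q b l.
Proof.
move=> w_prim a_le b_le.
have T i j : (i <= m)%N -> (j <= n)%N ->
   \sum_(k < N) (p ^ (m - i) %| k)%N%:R * (q ^ (n - j) %| k)%N%:R * w ^+ (k * l)
   = (p ^ i * (p ^ i %| l))%N%:R * (q ^ j * (q ^ j %| l))%N%:R.
  move=> i_le j_le.
  have N_def : N = (dv i j * (p ^ i * q ^ j))%N.
    by rewrite mulnACA -!expnD !subnK.
  have := w_prim; rewrite N_def => /sum_prim_root_dvdn-/(_ l).
  rewrite big_mkcond -N_def Gauss_dvd // -mulnb mulnACA -natrM => <-.
  apply: eq_bigr => k _; rewrite Gauss_dvd // -natrM mulnb.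
  by case: (_ && _); rewrite ?mul1r ?mul0r.
rewrite big_mkcond /=.
under eq_bigr => k _.
  rewrite (_ : (if _ then _ else _) = (gcdn k N == dv a b)%:R * w ^+ (k * l)); last first.
    by case: ifP; rewrite ?mul1r ?mul0r.
  rewrite gcdE // -mulnb natrM !gcdn_prime_power_eqE //.
  rewrite [X in X * _](_ : _ =
   (p ^ (m - a) %| k)%:R * (q ^ (n - b) %| k)%:R
   - (0 < b)%N%:R * ((p ^ (m - a) %| k)%:R * (q ^ (n - b.-1) %| k)%:R)
   - (0 < a)%N%:R * ((p ^ (m - a.-1) %| k)%:R * (q ^ (n - b) %| k)%:R)
   + (0 < a)%N%:R * (0 < b)%N%:R * ((p ^ (m - a.-1) %| k)%:R * (q ^ (n - b.-1) %| k)%:R)); last by ring.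
  rewrite mulrDl !mulrBl -!(mulrA _%:R (_ * _)) -(mulrA (_ * _) (_ * _)).
  over.
rewrite big_split !sumrB -!mulr_sumr !T ?(leq_trans (leq_pred _)) // /ramanujan_sum.
by rewrite /=; ring.
Qed.

(** Each divisor of [N] is [dv a b] for exactly one pair of indices, and [h (gcdn k N)] is constant
    on each gcd class. *)
Lemma partition_gcdn (R : pzRingType) (h f : nat -> R) :
  \sum_(k < N) h (gcdn k N) * f k
    = \sum_(a < m.+1) \sum_(b < n.+1)
        h (dv a b) * \sum_(k < N | gcdn k N == dv a b) f k.
Proof.
(* The truncated differences are at most [m] and [n], so [inord] never takes its default value. *)
pose g (k : nat) : 'I_m.+1 * 'I_n.+1 :=
  (inord (m - logn p (gcdn k N)), inord (n - logn q (gcdn k N))).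
have gE (k : nat) (a : 'I_m.+1) (b : 'I_n.+1) :
    (g k == (a, b)) = (gcdn k N == dv a b).
  have a_le : (a <= m)%N by rewrite -ltnS.
  have b_le : (b <= n)%N by rewrite -ltnS.
  rewrite gcdE // /g.
  have /(dvdn_pfactor _ _ p_prime)[e e_le ge] := dvdn_gcdr k (p ^ m).
  have /(dvdn_pfactor _ _ q_prime)[c c_le gc] := dvdn_gcdr k (q ^ n).
  have /eqP-> : gcdn k N == dv (m - e) (n - c).
    by rewrite gcdE ?leq_subr // !subKn // ge gc !eqxx.
  have p0 := prime_gt0 p_prime; have q0 := prime_gt0 q_prime.
  rewrite !subKn // !lognM ?expn_gt0 ?p0 ?q0 // !lognX !logn_prime // !eqxx.
  rewrite (eq_sym q) (negbTE p_neq_q) !muln0 !muln1 add0n addn0 ge gc.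
  rewrite !eqn_exp2l ?prime_gt1 // xpair_eqE -!val_eqE /= !inordK ?ltnS ?leq_subr //.
  by congr (_ && _); lia.
rewrite pair_big /= (partition_big (fun k : 'I_N => g k) predT) //=.
apply: eq_bigr => -[a b] _ /=; rewrite mulr_sumr.
by apply: eq_big => k; rewrite gE // => /eqP->.
Qed.

Lemma ramanujan_sum_totient (R : pzRingType) (r a l : nat) :
  prime r -> (r ^ a %| l)%N -> ramanujan_sum R r a l = (totient (r ^ a))%:R.
Proof.
move=> r_prime ra_dvd; rewrite /ramanujan_sum ra_dvd muln1.
case: a ra_dvd => [|a] ra_dvd; first by rewrite mul0r subr0 totient1.
rewrite mul1r /= (dvdn_trans _ ra_dvd) ?dvdn_exp2l // muln1 totient_pfactor //.
by rewrite -natrB ?leq_exp2l ?prime_gt1 // expnS -subn1 mulnBl mul1n.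
Qed.

Lemma ramanujan_sum_gcdn (R : pzRingType) (r a l M : nat) :
  (r ^ a %| M)%N -> ramanujan_sum R r a (gcdn l M) = ramanujan_sum R r a l.
Proof.
move=> raM; have raM' := dvdn_trans (dvdn_exp2l r (leq_pred a)) raM.
by rewrite /ramanujan_sum !dvdn_gcd raM raM' !andbT.
Qed.

Lemma icg_eigenvalueE (D : {fset nat}) (w : algC) (l : nat) :
  N.-primitive_root w ->
  icg_eigenvalue N D w l = \sum_(a < m.+1) \sum_(b < n.+1)
    (dv a b \in D)%:R * (ramanujan_sum algC p a l * ramanujan_sum algC q b l).
Proof.
move=> w_prim; rewrite /icg_eigenvalue.
rewrite (@partition_gcdn algC (fun k => (k \in D)%:R) (fun k => w ^+ (k * l))).
apply: eq_bigr => a _; apply: eq_bigr => b _.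
by rewrite sum_prim_root_gcdn // -ltnS.
Qed.

(** The eigenvalue at [l] depends only on [gcdn l N], so each gcd class counts with its full
    size. *)
Lemma icg_multiplicity (D : {fset nat}) (w x : algC) :
  N.-primitive_root w ->
  count_mem x [seq icg_eigenvalue N D w l | l <- iota 0 N]
    = (\sum_(a < m.+1) \sum_(b < n.+1)
        (icg_eigenvalue N D w (dv a b) == x)
          * (totient (p ^ a) * totient (q ^ b)))%N.
Proof.
move=> w_prim; apply/eqP; rewrite -(eqr_nat algC); apply/eqP.
rewrite count_map -sum1_count natr_sum -(subn0 N) -/(index_iota 0 N) big_mkord subn0.
rewrite big_mkcond /=.
(* The trivial factor [w ^+ (l * 0)] turns class sizes into root-of-unity sums at 0, where Ramanujan
   sums are totients. *)
transitivity (\sum_(l < N)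
  (icg_eigenvalue N D w (gcdn l N) == x)%:R * w ^+ (l * 0)).
  apply: eq_bigr => l _; rewrite muln0 mulr1.
  suff -> : icg_eigenvalue N D w (gcdn l N) = icg_eigenvalue N D w l by case: eqP.
  rewrite !icg_eigenvalueE //; apply: eq_bigr => a _; apply: eq_bigr => b _.
  congr (_ * (_ * _)).
    apply: ramanujan_sum_gcdn; apply: dvdn_mulr; apply: dvdn_exp2l.
    by rewrite -ltnS.
  apply: ramanujan_sum_gcdn; apply: dvdn_mull; apply: dvdn_exp2l.
  by rewrite -ltnS.
rewrite (@partition_gcdn algC (fun k => (icg_eigenvalue N D w k == x)%:R)
   (fun k => w ^+ (k * 0))).
rewrite natr_sum; apply: eq_bigr => a _; rewrite natr_sum; apply: eq_bigr => b _.
have a_le : (a <= m)%N by rewrite -ltnS.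
have b_le : (b <= n)%N by rewrite -ltnS.
rewrite (sum_prim_root_gcdn algC w a b 0 w_prim a_le b_le).
by rewrite !ramanujan_sum_totient ?dvdn0 // -!natrM.
Qed.

(* [q - 1] divides [totient (q ^ b)] for [b > 0], so only [b = 0] survives. *)
Lemma icg_multiplicity_mod (D : {fset nat}) (w x : algC) :
  N.-primitive_root w ->
  (count_mem x [seq icg_eigenvalue N D w l | l <- iota 0 N]
    = \sum_(a < m.+1)
        (icg_eigenvalue N D w (p ^ (m - a) * q ^ n) == x) * totient (p ^ a)
    %[mod q - 1])%N.
Proof.
move=> w_prim; rewrite icg_multiplicity //.
under eq_bigr => a _ do rewrite big_ord_recl /= subn0 totient1 muln1.
rewrite big_split /= addnC; apply/eqP.
rewrite -[X in _ == X %[mod _]]add0n eqn_modDr mod0n.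
apply: dvdn_sum => a _; apply: dvdn_sum => b _.
by rewrite (totient_pfactor q_prime) // -subn1 dvdn_mull // dvdn_mull // dvdn_mulr.
Qed.

(** At a multiple of [q ^ n] every Ramanujan sum for a power of [q] is a totient, so the sum over
    [b] collapses to a weight. *)
Lemma icg_eigenvalue_pfactor (D : {fset nat}) (w : algC) (c : nat) :
  N.-primitive_root w ->
  icg_eigenvalue N D w (p ^ c * q ^ n) = \sum_(a < m.+1)
    ramanujan_sum algC p a (p ^ c)
      * (symbol_weight p q m n D a)%:R.
Proof.
move=> w_prim; rewrite icg_eigenvalueE //.
apply: eq_bigr => a _; rewrite /symbol_weight natr_sum mulr_sumr; apply: eq_bigr => b _.
rewrite (@ramanujan_sum_totient _ q) //; last first.
  by rewrite dvdn_mull // dvdn_exp2l // -ltnS.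
rewrite {1}/ramanujan_sum !Gauss_dvdl // -/(ramanujan_sum _ _ _ _).
by rewrite natrM mulrCA.
Qed.
End TwoPrimes.

(** * Uniqueness of totient expansions and of weighted multiplicities *)

Lemma sum_totient_digits_lt (q P n : nat) (e : nat -> nat) :
  prime q -> (P < q - 1)%N -> (forall b, e b <= P)%N ->
  (\sum_(b < n) e b * totient (q ^ b) < totient (q ^ n))%N.
Proof.
move=> q_prime P_lt e_le; elim: n => [|n IH]; first by rewrite big_ord0.
rewrite big_ord_recr /=.
(* The next totient is [q - 1] times [totient (q ^ n)] if [n = 0] and [q] times it if [n > 0]. *)
apply: (@leq_trans ((q - 1) * totient (q ^ n))%N); last first.
  case: n {IH} => [|n]; first by rewrite muln1 totient_pfactor // muln1 subn1.
  by rewrite !totient_pfactor //= expnS mulnCA leq_mul2l leq_mul2r leq_subr !orbT.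
apply: (@leq_trans ((1 + e n) * totient (q ^ n))%N); first by rewrite mulnDl mul1n ltn_add2r.
by rewrite leq_mul2r (leq_ltn_trans (e_le n)) ?orbT.
Qed.

(** The lower digits sum to less than [totient (q ^ n)], so the top digit is the quotient by it;
    induction gives the others. *)
Lemma totient_digits_inj (q P n : nat) (e e' : nat -> nat) :
  prime q -> (P < q - 1)%N -> (forall b, e b <= P)%N -> (forall b, e' b <= P)%N ->
  (\sum_(b < n) e b * totient (q ^ b) = \sum_(b < n) e' b * totient (q ^ b))%N ->
  forall b, (b < n)%N -> e b = e' b.
Proof.
move=> q_prime P_lt e_le e'_le; elim: n => [|n IH] //.
rewrite !big_ord_recr /= => E.
have t0 : (0 < totient (q ^ n))%N by rewrite totient_gt0 expn_gt0 prime_gt0.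
have lt := sum_totient_digits_lt _ _ n _ q_prime P_lt e_le.
have lt' := sum_totient_digits_lt _ _ n _ q_prime P_lt e'_le.
have En : e n = e' n.
  by have := congr1 (divn^~ (totient (q ^ n))) E; rewrite !divnDr ?dvdn_mull // !mulnK // !divn_small.
move: E; rewrite En => /addIn/IH {}IH b; rewrite ltnS leq_eqVlt => /predU1P[->//|].
exact: IH.
Qed.

(* [x0] is found by parity ([q - 1] is even, the other weights are too), then
   [x1] because [q - 1] divides none of [p - 1], [p ^ 2 - 1], [(p - 1) ^ 2]. *)
Lemma weighted_multiplicity_inj (T : eqType) (p q : nat) (x0 x1 x2 y0 y1 y2 : T) :
  odd p -> odd q -> ~~ (q - 1 %| (p - 1) ^ 2 * (p + 1))%N ->
  (forall z,
    (x0 == z) + (x1 == z) * (p - 1) + (x2 == z) * (p * (p - 1))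
    = (y0 == z) + (y1 == z) * (p - 1) + (y2 == z) * (p * (p - 1)) %[mod q - 1])%N ->
  [/\ x0 = y0, x1 = y1 & x2 = y2 \/ (q - 1 %| p * (p - 1))%N].
Proof.
move=> p_odd q_odd ndiv mE.
have ndivP x : (x %| (p - 1) ^ 2 * (p + 1))%N -> ~~ (q - 1 %| x)%N.
  by move=> x_dvd; apply: contra ndiv => /dvdn_trans->.
have E0 : x0 = y0.
  have q2 : (2 %| q - 1)%N by rewrite dvdn2 oddB ?odd_gt0 // q_odd.
  have := congr1 (modn^~ 2) (mE x0); rewrite !modn_dvdm // !modn2.
  rewrite !oddD !oddM !oddB ?odd_gt0 // p_odd /= !andbF !addbF eqxx /= oddb.
  by case: eqP.
have {}mE z : ((x1 == z) * (p - 1) + (x2 == z) * (p * (p - 1))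
    = (y1 == z) * (p - 1) + (y2 == z) * (p * (p - 1)) %[mod q - 1])%N.
  by have := mE z; rewrite E0 -!addnA => /eqP; rewrite eqn_modDl => /eqP.
have E1 : x1 = y1.
  apply/eqP/contraT => x1y1.
  have := mE x1; rewrite eqxx (eq_sym y1) (negbTE x1y1) mul1n mul0n add0n => /eqP.
  have [_|_] := eqVneq x2 x1; have [_|_] := eqVneq y2 x1; rewrite ?mul1n ?mul0n ?addn0.
  - rewrite -[X in _ == X %[mod _]]add0n eqn_modDr mod0n.
    apply: contraTT => _; apply: ndivP; by rewrite -mulnA dvdn_mulr.
  - rewrite -mulSn mod0n; apply: contraTT => _; apply: ndivP.
    by rewrite -mulnA dvdn_mull // mulnC addn1.
  - rewrite eq_sym eqn_mod_dvd ?leq_pmull ?odd_gt0 //; apply: contraTT => _; apply: ndivP.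
    by rewrite -{2}[(p - 1)%N]mul1n -mulnBl mulnn dvdn_mulr.
  - rewrite mod0n; apply: contraTT => _; apply: ndivP.
    by rewrite -mulnA dvdn_mulr.
split=> //; have := mE x2; rewrite E1 => /eqP; rewrite eqn_modDl eqxx mul1n.
have [->|_] := eqVneq y2 x2; first by left.
by rewrite mul0n mod0n; right.
Qed.

(** * Recovering the symbol when the exponent of [p] is 2 *)

Lemma icg_eigenvalue_p2 (p q n : nat) (D : {fset nat}) (w : algC) :
  prime p -> prime q -> p != q -> (p ^ 2 * q ^ n)%N.-primitive_root w ->
  let W a := (symbol_weight p q 2 n D a)%:R : algC in
  let ev c := icg_eigenvalue (p ^ 2 * q ^ n) D w (p ^ c * q ^ n) in
  [/\ ev 2%N = W 0%N + (p%:R - 1) * W 1%N + (p%:R ^+ 2 - p%:R) * W 2%N,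
      ev 1%N = W 0%N + (p%:R - 1) * W 1%N - p%:R * W 2%N
    & ev 0%N = W 0%N - W 1%N].
Proof.
move=> p_prime q_prime pq w_prim W ev; have p_gt1 := prime_gt1 p_prime.
have evE c : ev c = ramanujan_sum algC p 0 (p ^ c) * W 0%N
    + ramanujan_sum algC p 1 (p ^ c) * W 1%N
    + ramanujan_sum algC p 2 (p ^ c) * W 2%N.
  by rewrite /ev icg_eigenvalue_pfactor // !big_ord_recr big_ord0 /= add0r.
(* The Ramanujan sums for [p ^ 2] at [p ^ 2], [p], 1 are [p ^ 2 - p], [- p], 0; those for [p] are
   [p - 1], [p - 1], -1. *)
split; rewrite evE /ramanujan_sum /= !dvdn_Pexp2l //= !muln1 ?muln0 !expn0 ?expn1 ?natrX; ring.
Qed.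

Lemma sub_symbol (p q m n : nat) (D D' : {fset nat}) :
  prime p -> prime q -> p != q ->
  integral_symbol (p ^ m * q ^ n) D ->
  (forall a b, (a <= m)%N -> (b <= n)%N ->
    (p ^ (m - a) * q ^ (n - b))%N \in D -> (p ^ (m - a) * q ^ (n - b))%N \in D') ->
  {subset D <= D'}.
Proof.
move=> p_prime q_prime pq isD sub d dD.
have [/gcdn_idPl d_dvd _ _] := isD d dD.
have pq_coprime : coprime (p ^ m) (q ^ n).
  exact: coprime_prime_powers.
have /(dvdn_pfactor _ _ p_prime)[i i_le gi] := dvdn_gcdr d (p ^ m).
have /(dvdn_pfactor _ _ q_prime)[j j_le gj] := dvdn_gcdr d (q ^ n).
move: dD; rewrite -d_dvd gcdnM_coprime // gi gj -(subKn i_le) -(subKn j_le).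
by apply: sub; rewrite leq_subr.
Qed.

Lemma bool_digits_inj (c : nat) (x0 x1 y0 y1 : bool) : (1 < c)%N ->
  (x0 + c * x1 = y0 + c * y1)%N -> x0 = y0 /\ x1 = y1.
Proof. by case: x0 x1 y0 y1 => [] [] [] []; rewrite ?muln1 ?muln0; lia. Qed.

Lemma symbol_weight_inj (p q m n : nat) (D D' : {fset nat}) (a b : nat) :
  prime q -> odd q -> (b <= n)%N ->
  symbol_weight p q m n D a = symbol_weight p q m n D' a ->
  ((p ^ (m - a) * q ^ (n - b))%N \in D) = ((p ^ (m - a) * q ^ (n - b))%N \in D').
Proof.
move=> q_prime q_odd b_le.
move/(totient_digits_inj q 1 n.+1
  (fun b => (p ^ (m - a) * q ^ (n - b))%N \in D : nat)
  (fun b => (p ^ (m - a) * q ^ (n - b))%N \in D' : nat) q_prime) => E.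
have /E {}E : (1 < q - 1)%N by have := odd_prime_gt2 q_odd q_prime; lia.
have : ((p ^ (m - a) * q ^ (n - b))%N \in D : nat)
    = ((p ^ (m - a) * q ^ (n - b))%N \in D') by apply: E => // ?; exact: leq_b1.
by do 2!case: (_ \in _).
Qed.

(** The combination is an expansion with digits 0, 1, [c], [c + 1], distinct because [c > 1] and
    below [q - 1]; each digit encodes two memberships. *)
Lemma symbol_weight_pair_inj (p q m n c : nat) (D D' : {fset nat}) (a0 a1 b : nat) :
  prime q -> (1 < c)%N -> (c.+1 < q - 1)%N -> (b <= n)%N ->
  (symbol_weight p q m n D a0 + c * symbol_weight p q m n D a1
    = symbol_weight p q m n D' a0 + c * symbol_weight p q m n D' a1)%N ->
  ((p ^ (m - a0) * q ^ (n - b))%N \in D) = ((p ^ (m - a0) * q ^ (n - b))%N \in D')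
  /\ ((p ^ (m - a1) * q ^ (n - b))%N \in D) = ((p ^ (m - a1) * q ^ (n - b))%N \in D').
Proof.
move=> q_prime c_gt1 c_lt b_le E.
pose dg (X : {fset nat}) k :=
  (((p ^ (m - a0) * q ^ (n - k))%N \in X) + c * ((p ^ (m - a1) * q ^ (n - k))%N \in X))%N.
have dgE X : (symbol_weight p q m n X a0 + c * symbol_weight p q m n X a1
    = \sum_(k < n.+1) dg X k * totient (q ^ k))%N.
  rewrite big_distrr -big_split; apply: eq_bigr => k _ /=.
  by rewrite mulnDl mulnA.
have dg_le X k : (dg X k <= c.+1)%N.
  by rewrite /dg; do 2!case: (_ \in _); rewrite ?muln1 ?muln0 ?add0n ?addn0 //; lia.
move: E; rewrite !dgE => /(totient_digits_inj _ _ _ _ _ q_prime c_lt (dg_le D) (dg_le D')).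
move=> /(_ b); rewrite ltnS => /(_ b_le).
exact: bool_digits_inj.
Qed.

Lemma icg_p2_spectrum_inj (p q n : nat) (D D' : {fset nat}) :
  prime p -> odd p -> prime q -> odd q ->
  ~~ (q - 1 %| (p - 1) ^ 2 * (p + 1))%N ->
  integral_symbol (p ^ 2 * q ^ n) D -> integral_symbol (p ^ 2 * q ^ n) D' ->
  graph_spectrum (ICG (p ^ 2 * q ^ n) D) = graph_spectrum (ICG (p ^ 2 * q ^ n) D') ->
  D = D'.
Proof.
move=> p_prime p_odd q_prime q_odd ndiv isD isD' specE.
have p_gt2 := odd_prime_gt2 p_odd p_prime.
(* If [p = q], then [q - 1] is [p - 1], which divides the product in [ndiv]. *)
have pq : p != q by apply: contraNneq ndiv => <-; rewrite -mulnA dvdn_mulr.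
have [|w w_prim] := @C_prim_root_exists (p ^ 2 * q ^ n).
  by rewrite muln_gt0 !expn_gt0 (prime_gt0 p_prime) (prime_gt0 q_prime).
move: specE; rewrite !(icg_spectrum _ _ _ w_prim) => /eq_seq_msetP/permP countE.
pose ev X c := icg_eigenvalue (p ^ 2 * q ^ n) X w (p ^ c * q ^ n).
have countME X z :
    (count_mem z [seq icg_eigenvalue (p ^ 2 * q ^ n) X w l | l <- iota 0 (p ^ 2 * q ^ n)]
     = (ev X 2 == z) + (ev X 1 == z) * (p - 1) + (ev X 0 == z) * (p * (p - 1))
     %[mod q - 1])%N.
  have t1 : totient (p ^ 1) = (p - 1)%N by rewrite totient_prime // subn1.
  have t2 : totient (p ^ 2) = (p * (p - 1))%N by rewrite totient_pfactor // mulnC subn1.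
  by rewrite icg_multiplicity_mod // !big_ord_recr big_ord0 /= totient1 t1 t2 muln1.
have [|E2 E1 E0] := weighted_multiplicity_inj _ p q (ev D 2) (ev D 1) (ev D 0)
    (ev D' 2) (ev D' 1) (ev D' 0) p_odd q_odd ndiv _.
  by move=> z; rewrite -!countME countE.
pose W X a := symbol_weight p q 2 n X a.
have [D2 D1 D0] := icg_eigenvalue_p2 p q n D w p_prime q_prime pq w_prim.
have [D'2 D'1 D'0] := icg_eigenvalue_p2 p q n D' w p_prime q_prime pq w_prim.
have pR0 : p%:R != 0 :> algC by rewrite pnatr_eq0 -lt0n prime_gt0.
(* The difference of the first two eigenvalues is [p ^ 2 * W 2]. *)
have W2 : W D 2 = W D' 2.
  apply/eqP; rewrite -(eqr_nat algC) -(inj_eq (mulfI (expf_neq0 2 pR0))); apply/eqP.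
  transitivity (ev D 2 - ev D 1); first by rewrite /ev D2 D1 /W; ring.
  by rewrite E2 E1 /ev D'2 D'1 /W; ring.
have W01 : (W D 0 + (p - 1) * W D 1 = W D' 0 + (p - 1) * W D' 1)%N.
  apply/eqP; rewrite -(eqr_nat algC) !natrD !natrM natrB ?prime_gt0 //; apply/eqP.
  transitivity (ev D 1 + p%:R * (W D 2)%:R); first by rewrite /ev D1 /W; ring.
  by rewrite E1 W2 /ev D'1 /W; ring.
have memE a b : (a <= 2)%N -> (b <= n)%N ->
    ((p ^ (2 - a) * q ^ (n - b))%N \in D) = ((p ^ (2 - a) * q ^ (n - b))%N \in D').
  move=> a_le b_le.
  case: E0 => [E0|div].
    (* With [W 2] known, adding [p * W 2] to the second eigenvalue and subtracting the third leaves
       [p * W 1]. *)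
    have W1 : W D 1 = W D' 1.
      apply/eqP; rewrite -(eqr_nat algC) -(inj_eq (mulfI pR0)); apply/eqP.
      transitivity (ev D 1 + p%:R * (W D 2)%:R - ev D 0); first by rewrite /ev D1 D0 /W; ring.
      by rewrite E1 E0 W2 /ev D'1 D'0 /W; ring.
    move: W01; rewrite W1 => /addIn W0.
    by apply: symbol_weight_inj => //; case: a a_le => [|[|[]]].
  (* Now [q - 1] divides [p * (p - 1)] but not [p - 1], so [q] is large enough
     for [W 0 + (p - 1) * W 1] to determine its digits. *)
  have p_lt : ((p - 1).+1 < q - 1)%N.
    have q_gt2 := odd_prime_gt2 q_odd q_prime.
    (* Otherwise [q - 1] would be coprime to [p] and hence divide [p - 1]. So [p <= q - 1], and
       parity excludes equality. *)
    have /dvdn_leq : (p %| q - 1)%N.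
      apply: contraNT ndiv => p_ndvd.
      move: div; rewrite Gauss_dvdr; last by rewrite coprime_sym prime_coprime.
      by move=> div; rewrite -mulnA dvdn_mulr.
    have : (q - 1 != p)%N.
      by apply: contraTneq p_odd => <-; rewrite oddB ?odd_gt0 // q_odd.
    by lia.
  have c_gt1 : (1 < p - 1)%N by lia.
  have [M0 M1] := symbol_weight_pair_inj _ _ _ _ _ _ _ _ _ _ q_prime c_gt1 p_lt b_le W01.
  case: a a_le => [|[|[]]] // _.
  exact: symbol_weight_inj.
apply/fsetP => d; apply/idP/idP.
  by apply: (sub_symbol p q 2 n D D' p_prime q_prime pq isD) => a b *; rewrite -memE.
by apply: (sub_symbol p q 2 n D' D p_prime q_prime pq isD') => a b *; rewrite memE.
Qed.

Theorem theorem6p1 (p q n2 : nat) (p_prime : prime p) (p_odd : odd p)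
    (q_prime : prime q) (q_odd : odd q) (n2_ge1 : (1 <= n2)%N)
    (ndiv : ~~ (q - 1 %| (p - 1) ^ 2 * (p + 1))%N) :
  ISAP (p ^ 2 * q ^ n2)%N.
Proof.
move=> D D' isD isD'; split=> [|-> //].
exact: icg_p2_spectrum_inj.
Qed.
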